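(* At a point $(x,0,0)\in\Lambda$ (and for given regularization functions $\psi,\phi$) there exists at most one stable (i.e. attracting) sliding vector field.
   Context: Setting. Let $\mathcal U\subset\mathbb R^3$ with coordinates $(x,y,z)$, $\mathcal I$ an interval, $\Lambda=\{(x,0,0):x\in\mathcal I\}$, $\mathcal Q_1=\{y\ge0,z\ge0\}$, $\mathcal Q_2=\{y\le0,z\ge0\}$, $\mathcal Q_3=\{y\le0,z\le0\}$, $\mathcal Q_4=\{y\ge0,z\le0\}$. The piecewise smooth system is $(\dot x,\dot y,\dot z)^T=X_i$ on $\mathcal Q_i$ with smooth $X_i=(\alpha_i,\beta_i,\gamma_i)^T$, $i=1,\dots,4$; standing assumption: $\alpha_i,\beta_i,\gamma_i$ depend only on $x$. Put $\tilde X_i=(\beta_i,\gamma_i)^T$. For $x\in\mathcal I$ and $(\psi,\phi)\in(-1,1)^2$ let $$\tilde F_x(\psi,\phi)=\tfrac12\Big(\tfrac{\tilde X_1}{2}(1+\phi)+\tfrac{\tilde X_4}{2}(1-\phi)\Big)(1+\psi)+\tfrac12\Big(\tfrac{\tilde X_2}{2}(1+\phi)+\tfrac{\tilde X_3}{2}(1-\phi)\Big)(1-\psi).$$ Sliding. Sliding vector fields at $(x,0,0)$ correspond to the zeros $(\psi_*,\phi_* )\in(-1,1)^2$ of $\tilde F_x$: with $\sigma_\psi=(1+\psi_* )/2$, $\sigma_\phi=(1+\phi_* )/2$, the sliding vector field has $x$-component $\sigma_\psi\sigma_\phi\alpha_1+(1-\sigma_\psi)\sigma_\phi\alpha_2+(1-\sigma_\psi)(1-\sigma_\phi)\alpha_3+\sigma_\psi(1-\sigma_\phi)\alpha_4$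 and vanishing $y,z$-components. Regularization functions. A regularization function is a smooth ($C^{k}$, $k\ge1$) function $\phi:\mathbb R\to[-1,1]$ with $\phi'(s)>0$ whenever $\phi(s)\in(-1,1)$, $\phi(s)\to\pm1$ as $s\to\pm\infty$, and such that the functions $\phi_\pm$ given by $\phi_\pm(0)=\pm1$, $\phi_\pm(r)=\phi(r^{-1})$ for $r\gtrless0$ are smooth on $[0,\infty)$, respectively $(-\infty,0]$. Two such functions $\psi,\phi$ are fixed. Stability. For a zero $(\psi_*,\phi_* )$ of $\tilde F_x$ let $\hat y_*=\psi^{-1}(\psi_* )$, $\hat z_*=\phi^{-1}(\phi_* )$ and let $\mathbf J=\mathbf D\tilde F_x(\psi_*,\phi_* )\,\mathrm{diag}(\psi'(\hat y_* ),\phi'(\hat z_* ))$ be the Jacobian at $(\hat y_*,\hat z_* )$ of the planar layer problem $(\hat y',\hat z')^T=\tilde F_x(\psi(\hat y),\phi(\hat z))$. The corresponding sliding vector field is attracting (stable) if both eigenvalues of $\mathbf J$ have negative real part. *)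

(* Defs.v *)
From HB Require Import structures.
From mathcomp Require Import all_boot all_order all_algebra.
From mathcomp Require Import all_classical all_reals all_analysis.
From mathcomp Require Import complex.

Set Implicit Arguments.
Unset Strict Implicit.
Unset Printing Implicit Defensive.

Import Order.TTheory GRing.Theory Num.Theory.
Import numFieldNormedType.Exports.

Local Open Scope classical_set_scope.
Local Open Scope ring_scope.

(* Only meaningful for [V] open.  In finite dimension, continuity of all
   iterated directional derivatives up to order [k] is the usual C^k. *)
Fixpoint Ck (R : realType) (E F : normedModType R) (k : nat)
    (V : set E) (f : E -> F) : Prop :=
  (forall p, V p -> {for p, continuous f}) /\
  if k is k'.+1 then
    forall v : E, (forall p, V p -> derivable f p v) /\ Ck k' V ('D_v f)
  else True.

(* Smoothness on an arbitrary set (a quadrant, a closed half-line): near each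
   point of [D], [f] agrees on [D] with a C^k function on an open set. *)
Definition Ck_on (R : realType) (E F : normedModType R) (k : nat)
    (D : set E) (f : E -> F) : Prop :=
  forall p, D p -> exists (V : set E) (g : E -> F),
    [/\ open V, V p, Ck k V g & forall q, V q -> D q -> f q = g q].

Definition vec2 (R : realType) (a b : R) : 'rV[R]_2 :=
  \row_(j < 2) [:: a; b]`_j.

Definition vec3 (R : realType) (a b c : R) : 'rV[R]_3 :=
  \row_(j < 3) [:: a; b; c]`_j.

Variant quadrant := Q1 | Q2 | Q3 | Q4.

Definition region (R : realType) (i : quadrant) : set 'rV[R]_3 :=
  [set p | match i with
           | Q1 => (0 <= p 0 1) && (0 <= p 0 2%:R)
           | Q2 => (p 0 1 <= 0) && (0 <= p 0 2%:R)
           | Q3 => (p 0 1 <= 0) && (p 0 2%:R <= 0)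
           | Q4 => (0 <= p 0 1) && (p 0 2%:R <= 0)
           end].

Definition Lambda (R : realType) (I : interval R) : set 'rV[R]_3 :=
  [set vec3 x 0 0 | x in [set` I]].

(* [X i] is only constrained on [U `&` region i]. *)
Record pws_system (R : realType) (k : nat) (U : set 'rV[R]_3)
    (I : interval R) (X : quadrant -> 'rV[R]_3 -> 'rV[R]_3) : Prop := {
  pws_Lambda : Lambda I `<=` U ;
  pws_smooth : forall i, Ck_on k (U `&` @region R i) (X i) ;
  pws_only_x : forall i (p q : 'rV[R]_3),
    (U `&` @region R i) p -> (U `&` @region R i) q ->
    p 0 0 = q 0 0 -> X i p = X i q
}.

Section Sliding.
Variables (R : realType) (X : quadrant -> 'rV[R]_3 -> 'rV[R]_3).

Definition alpha (i : quadrant) (x : R) : R := X i (vec3 x 0 0) 0 0.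
Definition beta (i : quadrant) (x : R) : R := X i (vec3 x 0 0) 0 1.
Definition gamma (i : quadrant) (x : R) : R := X i (vec3 x 0 0) 0 2%:R.

Definition tildeX (i : quadrant) (x : R) : 'rV[R]_2 :=
  vec2 (beta i x) (gamma i x).

(* The argument is [u = (psi, phi)]; the formula makes sense off (-1,1)^2. *)
Definition tildeF (x : R) (u : 'rV[R]_2) : 'rV[R]_2 :=
  ((1 + u 0 0) / 2) *: (((1 + u 0 1) / 2) *: tildeX Q1 x
                      + ((1 - u 0 1) / 2) *: tildeX Q4 x)
  + ((1 - u 0 0) / 2) *: (((1 + u 0 1) / 2) *: tildeX Q2 x
                        + ((1 - u 0 1) / 2) *: tildeX Q3 x).

Definition sliding_zero (x : R) (u : 'rV[R]_2) : Prop :=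
  [/\ u 0 0 \in `]-1, 1[, u 0 1 \in `]-1, 1[ & tildeF x u = 0].

Definition sliding_vector (x : R) (u : 'rV[R]_2) : 'rV[R]_3 :=
  let s := (1 + u 0 0) / 2 in
  let t := (1 + u 0 1) / 2 in
  vec3 (s * t * alpha Q1 x + (1 - s) * t * alpha Q2 x
        + (1 - s) * (1 - t) * alpha Q3 x + s * (1 - t) * alpha Q4 x) 0 0.

(* Sliding vector fields correspond to zeros of [tildeF x], so the zero is kept
   as part of the data: distinct zeros count as distinct even when the vectors
   they produce coincide. *)
Definition sliding_vector_field (x : R) (u : 'rV[R]_2) (v : 'rV[R]_3) : Prop :=
  sliding_zero x u /\ v = sliding_vector x u.

End Sliding.

(* The values of [phi_plus] on negative arguments (resp. of [phi_minus] on
   positive ones) are junk. *)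
Definition phi_plus (R : realType) (phi : R -> R) (r : R) : R :=
  if r == 0 then 1 else phi r^-1.
Definition phi_minus (R : realType) (phi : R -> R) (r : R) : R :=
  if r == 0 then -1 else phi r^-1.

Record regularization (R : realType) (k : nat) (phi : R -> R) : Prop := {
  reg_range : forall s, phi s \in `[-1, 1] ;
  reg_smooth : Ck k [set: R] phi ;
  reg_deriv : forall s, phi s \in `]-1, 1[ -> 0 < phi^`()%classic s ;
  reg_pinfty : phi s @[s --> +oo] --> (1 : R) ;
  reg_ninfty : phi s @[s --> -oo] --> (-1 : R) ;
  reg_plus : Ck_on k [set` `[0, +oo[ : interval R] (phi_plus phi) ;
  reg_minus : Ck_on k [set` `]-oo, 0] : interval R] (phi_minus phi)
}.

(* A regularization function is injective only where its values lie in (-1,1);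
   it may be constant equal to 1 or to -1 outside. *)
Definition reg_inv (R : realType) (phi : R -> R) : R -> R :=
  'pinv_(fun=> 0) [set s | phi s \in `]-1, 1[] phi.

(* ['J f p] acts on row vectors from the right, hence the transpose. *)
Definition layer_jacobian (R : realType)
    (X : quadrant -> 'rV[R]_3 -> 'rV[R]_3) (psi phi : R -> R)
    (x : R) (u : 'rV[R]_2) : 'M[R]_2 :=
  ('J (tildeF X x) u)^T *m
  diag_mx (vec2 (psi^`()%classic (reg_inv psi (u 0 0)))
                (phi^`()%classic (reg_inv phi (u 0 1)))).

Definition eigenvalues_Re_neg (R : realType) (n : nat) (A : 'M[R]_n) : Prop :=
  forall l : R[i],
    eigenvalue (map_mx (real_complex R) A) l -> complex.Re l < 0.

Definition stable_sliding_vector_field (R : realType)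
    (X : quadrant -> 'rV[R]_3 -> 'rV[R]_3) (psi phi : R -> R)
    (x : R) (u : 'rV[R]_2) (v : 'rV[R]_3) : Prop :=
  sliding_vector_field X x u v /\
  eigenvalues_Re_neg (layer_jacobian X psi phi x u).

(* Main.v *)
(* [tildeF X x] is biaffine in [u = (psi, phi)].  If it vanishes at [u1] and
   [u2], the quadratic Taylor expansion about the midpoint [m] is exact, so
   [DF(m) (u2 - u1) = 0].  The determinant of [DF] is affine in [u], because the
   quadratic term has coefficient [det (d, d) = 0], where [d] is the coefficient
   of [psi * phi]; hence
   [det DF(u1) + det DF(u2) = 2 det DF(m)].  Stability forces [det J > 0], so
   [det DF > 0] as [psi', phi' > 0], at both zeros: then [DF(m)] is invertible
   and [u1 = u2]. *)
Require Import Defs.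
From HB Require Import structures.
From mathcomp Require Import all_boot all_order all_algebra.
From mathcomp Require Import all_classical all_reals all_analysis.
From mathcomp Require Import complex.
From mathcomp Require Import ring lra.

Set Implicit Arguments.
Unset Strict Implicit.
Unset Printing Implicit Defensive.

Import Order.TTheory GRing.Theory Num.Theory.
Import numFieldNormedType.Exports.

Local Open Scope classical_set_scope.
Local Open Scope ring_scope.

Lemma det_mx2 (R : comNzRingType) (A : 'M[R]_2) :
  \det A = A 0 0 * A 1 1 - A 0 1 * A 1 0.
Proof.
rewrite (expand_det_row _ 0) !big_ord_recl big_ord0 addr0 /cofactor.
rewrite !det_mx11 !mxE /=.
have -> : lift ord0 ord0 = 1 :> 'I_2 by exact: val_inj.
have -> : lift 1 0 = 0 :> 'I_2 by exact: val_inj.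
by rewrite expr0 expr1; ring.
Qed.

(** By contraposition: if the determinant were nonpositive, the discriminant of the characteristic
    polynomial would be at least the squared trace, so its larger root would be real and
    nonnegative. *)
Lemma det_gt0_of_eigenvalues_Re_neg (R : realType) (A : 'M[R]_2) :
  eigenvalues_Re_neg A -> 0 < \det A.
Proof.
move=> hA; rewrite ltNge; apply/negP => detA.
pose t := A 0 0 + A 1 1.
pose r := (t + Num.sqrt (t ^+ 2 - 4 * \det A)) / 2.
have disc : t ^+ 2 <= t ^+ 2 - 4 * \det A by lra.
have disc0 : 0 <= t ^+ 2 - 4 * \det A by exact: le_trans (sqr_ge0 t) disc.
have r0 : 0 <= r.
  have : `|t| <= Num.sqrt (t ^+ 2 - 4 * \det A).
    by rewrite -sqrtr_sqr ler_wsqrtr.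
  rewrite ler_norml => /andP[h _]; rewrite /r; lra.
have rootr : \det (A - r%:M) = 0.
  have : (2 * r - t) ^+ 2 = t ^+ 2 - 4 * \det A.
    by rewrite -(sqr_sqrtr disc0) /r; congr (_ ^+ 2); field.
  rewrite !det_mx2 !mxE /= /t => h; lra.
have : eigenvalue (map_mx (real_complex R) A) (real_complex R r).
  (* As [r] is real, an eigenvector can be sought over [R], in the kernel of [A - r%:M]. *)
  rewrite eigenvalue_map; apply/eigenvalueP.
  have /eqP/det0P[v v0 hv] := rootr.
  exists v => //; apply/eqP; rewrite -subr_eq0 -hv mulmxBr mul_mx_scalar //.
by move/hA => /=; rewrite ltNge r0.
Qed.

Lemma regularization_continuous (R : realType) (k : nat) (phi : R -> R) :
  regularization k phi -> continuous phi.
Proof.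
move=> /reg_smooth hphi s.
by case: k hphi => [|k] [cphi _]; exact: cphi.
Qed.

(** The limits at infinity and the intermediate value theorem give [y] a preimage, so the
    pseudo-inverse is a true right inverse at [y] and [reg_deriv] applies there. *)
Lemma regularization_deriv_gt0 (R : realType) (k : nat) (phi : R -> R) (y : R) :
  regularization k phi -> y \in `]-1, 1[ ->
  0 < phi^`()%classic (reg_inv phi y).
Proof.
move=> h y1; have cphi := regularization_continuous h.
have /andP[ym1 yp1] : -1 < y < 1 by rewrite in_itv /= in y1.
have [b yb] : exists b, y < phi b.
  apply: (@filter_ex _ (+oo : set_system R)).
  exact: (@cvgr_gt _ _ _ _ _ _ (reg_pinfty h) _ yp1).
have [a ya] : exists a, phi a < y.
  apply: (@filter_ex _ (-oo : set_system R)).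
  exact: (@cvgr_lt _ _ _ _ _ _ (reg_ninfty h) _ ym1).
have [c phic] : exists c, phi c = y.
  have cont c d : {within `[c, d], continuous phi}.
    exact: continuous_subspaceT.
  (* Monotonicity of [phi] has not been derived, so both orders of [a] and [b] are treated. *)
  have [ab|/ltW ba] := leP a b.
    have [|c _ <-] := @IVT _ _ _ _ y ab (cont _ _); last by exists c.
    by rewrite ge_min le_max (ltW ya) (ltW yb) ?orbT.
  have [|c _ <-] := @IVT _ _ _ _ y ba (cont _ _); last by exists c.
  by rewrite ge_min le_max (ltW ya) (ltW yb) ?orbT.
have phiK : phi (reg_inv phi y) = y.
  by rewrite /reg_inv pinvK// inE; exists c => //=; rewrite phic.
by apply: (reg_deriv h); rewrite phiK.
Qed.

Definition biaffine (R : realType) (w0 w1 w2 w3 : 'rV[R]_2) (u : 'rV[R]_2) :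
    'rV[R]_2 :=
  w0 + u 0 0 *: w1 + u 0 1 *: w2 + (u 0 0 * u 0 1) *: w3.

Section Biaffine.
Variables (R : realType) (w0 w1 w2 w3 : 'rV[R]_2).
Local Notation f := (biaffine w0 w1 w2 w3).

Lemma differentiable_biaffine (u : 'rV[R]_2) : differentiable f u.
Proof.
apply: differentiableD; first apply: differentiableD;
  first apply: differentiableD.
- exact: differentiable_cst.
- by apply: differentiableZl; exact: differentiable_coord.
- by apply: differentiableZl; exact: differentiable_coord.
- apply: differentiableZl.
  by apply: differentiableM; exact: differentiable_coord.
Qed.

(** The difference quotient is constant for nonzero [h]. This yields the partial derivatives, since
    a biaffine map is affine along each coordinate direction. *)
Lemma derive_along_affine (v w u : 'rV[R]_2) :
  (forall h, f (h *: v + u) - f u = h *: w) -> 'D_v f u = w.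
Proof.
move=> fw; apply/cvg_lim => //; apply: cvg_near_cst.
near=> h; rewrite /= fw scalerA mulVf ?scale1r //.
by near: h; exact: nbhs_dnbhs_neq.
Unshelve.
all: by end_near.
Qed.

Lemma row_jacobian_biaffine (u : 'rV[R]_2) :
  row 0 ('J f u) = w1 + u 0 1 *: w3 /\ row 1 ('J f u) = w2 + u 0 0 *: w3.
Proof.
have E i : row i ('J f u) = 'D_(delta_mx 0 i) f u.
  by rewrite rowE; apply/esym/deriveEjacobian; exact: differentiable_biaffine.
by split; rewrite E; apply: derive_along_affine => h;
  apply/rowP => j; rewrite !mxE /=; ring.
Qed.

Lemma det_jacobian_biaffine (u : 'rV[R]_2) :
  \det ('J f u) =
    (w1 0 0 + u 0 1 * w3 0 0) * (w2 0 1 + u 0 0 * w3 0 1)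
    - (w1 0 1 + u 0 1 * w3 0 1) * (w2 0 0 + u 0 0 * w3 0 0).
Proof.
have [/rowP r0 /rowP r1] := row_jacobian_biaffine u.
rewrite det_mx2; move: (r0 0) (r0 1) (r1 0) (r1 1).
by rewrite !mxE => -> -> -> ->.
Qed.

Lemma biaffine_zero_unique (u v : 'rV[R]_2) :
  f u = 0 -> f v = 0 -> 0 < \det ('J f u) -> 0 < \det ('J f v) -> u = v.
Proof.
move=> fu fv du dv; rewrite det_jacobian_biaffine in du.
rewrite det_jacobian_biaffine in dv.
have fE w j : f w 0 j =
    w0 0 j + w 0 0 * w1 0 j + w 0 1 * w2 0 j + w 0 0 * w 0 1 * w3 0 j.
  by rewrite !mxE.
have z w j : f w = 0 -> f w 0 j = 0 by move=> ->; rewrite mxE.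
have := addr_gt0 du dv; set D := (X in 0 < X) => /lt0r_neq0 DE.
(* Cramer's rule for [DF(m) (v - u) = f v - f u], where [D = 2 det DF(m)]. *)
have e0 : D * (v 0 0 - u 0 0) = 0.
  transitivity ((f v 0 0 - f u 0 0) * (2 * w2 0 1 + (u 0 0 + v 0 0) * w3 0 1)
    - (f v 0 1 - f u 0 1) * (2 * w2 0 0 + (u 0 0 + v 0 0) * w3 0 0)).
    by rewrite /D !fE; ring.
  by rewrite !z // !subrr !mul0r subrr.
have e1 : D * (v 0 1 - u 0 1) = 0.
  transitivity ((f v 0 1 - f u 0 1) * (2 * w1 0 0 + (u 0 1 + v 0 1) * w3 0 0)
    - (f v 0 0 - f u 0 0) * (2 * w1 0 1 + (u 0 1 + v 0 1) * w3 0 1)).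
    by rewrite /D !fE; ring.
  by rewrite !z // !subrr !mul0r subrr.
apply/rowP => j; apply/esym/eqP; rewrite -subr_eq0; apply/eqP/(mulfI DE).
rewrite mulr0; case: j => [[|[|//]] lj].
- by rewrite (_ : Ordinal lj = 0) //; exact: val_inj.
- by rewrite (_ : Ordinal lj = 1) //; exact: val_inj.
Qed.

End Biaffine.

(** Expand the products [(1 ± psi) (1 ± phi) / 4]: the sign of each [tildeX] is the value of 1,
    [psi], [phi] or [psi * phi] at the corner of the square belonging to its quadrant. *)
Lemma tildeF_biaffine (R : realType) (X : quadrant -> 'rV[R]_3 -> 'rV[R]_3)
    (x : R) :
  tildeF X x = biaffine
    (4^-1 *: (tildeX X Q1 x + tildeX X Q2 x + tildeX X Q3 x + tildeX X Q4 x))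
    (4^-1 *: (tildeX X Q1 x - tildeX X Q2 x - tildeX X Q3 x + tildeX X Q4 x))
    (4^-1 *: (tildeX X Q1 x + tildeX X Q2 x - tildeX X Q3 x - tildeX X Q4 x))
    (4^-1 *: (tildeX X Q1 x - tildeX X Q2 x + tildeX X Q3 x - tildeX X Q4 x)).
Proof.
apply/funext => u; apply/rowP => j; rewrite !mxE.
by field.
Qed.

(** The layer Jacobian has determinant [det DF] times [psi'] times [phi'], and both derivatives are
    positive. *)
Lemma stable_det_gt0 (R : realType) (k : nat)
    (X : quadrant -> 'rV[R]_3 -> 'rV[R]_3) (psi phi : R -> R)
    (x : R) (u : 'rV[R]_2) (v : 'rV[R]_3) :
  regularization k psi -> regularization k phi ->
  stable_sliding_vector_field X psi phi x u v ->
  0 < \det ('J (tildeF X x) u).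
Proof.
move=> hpsi hphi [[[u0 u1 _] _] /det_gt0_of_eigenvalues_Re_neg].
rewrite det_mulmx det_tr det_diag !big_ord_recl big_ord0 mulr1 !mxE /=.
by rewrite pmulr_lgt0 // mulr_gt0 // (regularization_deriv_gt0 hpsi,
  regularization_deriv_gt0 hphi).
Qed.

Theorem theorem3 (R : realType) (k : nat) (hk : (1 <= k)%N)
    (U : set 'rV[R]_3) (I : interval R)
    (X : quadrant -> 'rV[R]_3 -> 'rV[R]_3) (hX : pws_system k U I X)
    (psi phi : R -> R)
    (hpsi : regularization k psi) (hphi : regularization k phi)
    (x : R) (hx : x \in I) :
  forall (u1 u2 : 'rV[R]_2) (v1 v2 : 'rV[R]_3),
    stable_sliding_vector_field X psi phi x u1 v1 ->
    stable_sliding_vector_field X psi phi x u2 v2 ->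
    u1 = u2 /\ v1 = v2.
Proof.
move=> u1 u2 v1 v2 h1 h2.
have d1 := stable_det_gt0 hpsi hphi h1.
have d2 := stable_det_gt0 hpsi hphi h2.
case: h1 h2 => [[[_ _ z1] ->] _] [[[_ _ z2] ->] _].
(* Each vector has been replaced by the [sliding_vector] of its zero, so only the zeros need
   comparing. *)
suff -> : u1 = u2 by [].
by move: z1 z2 d1 d2; rewrite tildeF_biaffine; exact: biaffine_zero_unique.
Qed.
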